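(* Let $C: a_1x_1+\dots+a_nx_n\le K$ be an arbitrary Pseudo-Boolean constraint with positive integer coefficients $a_1,\dots,a_n$ and positive integer $K$, and let $a_M$ be its largest coefficient. For each $i\in\{1,\dots,n\}$ let $C_i$ be the constraint $a_1x_1+\dots+a_i\cdot 1+\dots+a_nx_n\le K$, i.e. $C$ assuming $x_i$ to be true. For every $i$ with $1\le i\le n$, encode $C_i$ by coefficient decomposition using a consistent SAT encoding of the ROBDD of the decomposed constraint (as defined in the context, with the root variable not forced to be true, and with fresh auxiliary variables for each $i$), and in addition add the binary clause $r_i\vee\overline{x}_i$, where $r_i$ is the auxiliary variable of the root of the ROBDD for $C_i$. Then the resulting clause set $S$ is a generalized arc-consistent (GAC) encoding of $C$, and it uses $\mathcal{O}(n^3\log a_M)$ clauses and auxiliary variables.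
   Context: Variables are Boolean ($0/1$). A partial assignment is a set of literals containing no pair $x,\overline{x}$. Unit propagation on a CNF $S$ and an assignment $A$: repeatedly, if some clause of $S$ has all its literals false except one undefined literal $l$, add $l$ to the assignment. A clause set $S$ (possibly with auxiliary variables) is an encoding of $C$ if the models of $S$, restricted to the variables of $C$, are exactly the models of $C$. It is GAC if, for every partial assignment $A$ to the variables of $C$ that can be extended to a model of $C$ and every variable $x$ such that $A\cup\{x\}$ cannot be extended to a model of $C$, unit propagation on $S$ and $A$ produces $\overline{x}$. ROBDD: for a fixed variable ordering, the unique reduced ordered binary decision diagram of a Boolean function (no node has two identical children, no two distinct nodes root isomorphic subdiagrams). SAT encoding of the ROBDD of a function $F$: a CNF over the variables of $F$ and one auxiliary variable per node, with a constant number of clauses per node, such that every assignment to the variables of $F$ becomes a model of the CNF when each node variable is given the value of the function represented by that node. It is consistent if, for every partial assignment $A$ to the variables of $F$, $A$ cannot be extended to a model of $F$ if and only if unit propagation produces $\overline{r}$, where $r$ is the auxiliary variable of the root. Examples, for a node with auxiliary variable $u$, selector variable $x$, and auxiliary variables $f,t$ of its false and true children: (a) the if-then-else encoding, with the six clauses $\overline{x}\wedge\overline{f}\to\overline{u}$, $\overline{x}\wedge f\to u$, $x\wedge\overline{t}\to\overline{u}$, $x\wedge t\to u$, $\overline{f}\wedge\overline{t}\to\overline{u}$, $f\wedge t\to u$; (b) the encoding with the two clauses $\overline{f}\to\overline{u}$ and $\overline{t}\wedge x\to\overline{u}$; in both cases with unit clauses making the variable of the True terminal true and that of the False terminal false.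 Coefficient decomposition of a constraint $D:\sum_r b_rx_r\le L$ with positive integer $b_r$: let $\delta_{m,r}\cdots\delta_{0,r}$ be the binary representation of $b_r$, where $m=\lfloor\log_2\max_r b_r\rfloor$. The constraint is rewritten as $\tilde D:\sum_{j=0}^{m}\sum_r 2^j\delta_{j,r}x_{j,r}\le L$, with clauses expressing $x_{j,r}=x_r$ for each pair with $\delta_{j,r}=1$. The ROBDD of $\tilde D$ is taken with the variables ordered first by increasing $j$, then by increasing $r$. *)

(* Defs.v *)
(* Mathematical Components. *)
From mathcomp Require Import all_boot all_order all_algebra.

Set Implicit Arguments.
Unset Strict Implicit.
Unset Printing Implicit Defensive.

(* (x, true) is the literal x and (x, false) is its negation. *)
Definition lit (V : finType) : finType := (V * bool)%type.
Definition neg (V : finType) (l : lit V) : lit V := (l.1, ~~ l.2).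
Definition clause (V : finType) : Type := seq (lit V).
Definition cnf (V : finType) : Type := seq (clause V).

Definition valuation (V : finType) : finType := {ffun V -> bool}.
Definition bfun (V : finType) : Type := valuation V -> bool.

Definition sat (V : finType) (y : valuation V) (S : cnf V) : bool :=
  all (has (fun l => y l.1 == l.2)) S.

Definition rename_lit (V W : finType) (f : V -> W) (l : lit V) : lit W :=
  (f l.1, l.2).
Definition rename (V W : finType) (f : V -> W) (S : cnf V) : cnf W :=
  map (map (rename_lit f)) S.

(* Partial assignments are sets of literals. *)
Definition consistent_lits (V : finType) (A : {set lit V}) : bool :=
  [forall l in A, neg l \notin A].
Definition extends (V : finType) (y : valuation V) (A : {set lit V}) : bool :=
  [forall l in A, y l.1 == l.2].
Definition extendable (V : finType) (F : bfun V) (A : {set lit V}) : bool :=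
  [exists y : valuation V, F y && extends y A].

Definition is_unit (V : finType) (A : {set lit V}) (c : clause V) (l : lit V)
    : bool :=
  [&& l \in c, l \notin A, neg l \notin A
    & all (fun l' => (l' == l) || (neg l' \in A)) c].

Inductive up_run (V : finType) (S : cnf V) (A : {set lit V})
    : {set lit V} -> Prop :=
| up_start : up_run S A A
| up_step B c l :
    up_run S A B -> c \in S -> is_unit B c l -> up_run S A (l |: B).

(* The choice of run matters only if S together with A is unsatisfiable. *)
Definition up_produces (V : finType) (S : cnf V) (A : {set lit V}) (l : lit V)
    : Prop :=
  exists2 B, up_run S A B & l \in B.

(* In a clause set over V + X, the variables in X are the auxiliary ones. *)
Definition inl_lits (V X : finType) (A : {set lit V}) : {set lit (V + X)%type} :=
  [set rename_lit inl l | l in A].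

Definition is_encoding (V X : finType) (F : bfun V) (S : cnf (V + X)%type)
    : Prop :=
  forall x : valuation V,
    F x <-> exists2 y : valuation (V + X)%type, sat y S & x = [ffun v => y (inl v)].

Definition propagates_GAC (V X : finType) (F : bfun V) (S : cnf (V + X)%type)
    : Prop :=
  forall A : {set lit V}, consistent_lits A -> extendable F A ->
  forall x : V, ~~ extendable F ((x, true) |: A) ->
  up_produces S (inl_lits X A) (inl x, false).

Definition is_GAC_encoding (V X : finType) (F : bfun V) (S : cnf (V + X)%type)
    : Prop :=
  is_encoding F S /\ propagates_GAC F S.

(* [Decision x f t]: selector x, false child f, true child t. *)
Variant bdd_node (V N : Type) : Type :=
| Terminal of bool
| Decision of V & N & N.
Arguments Terminal {V N} _.
Arguments Decision {V N} _ _ _.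

Definition map_children (V N N' : Type) (f : N -> N') (d : bdd_node V N)
    : bdd_node V N' :=
  match d with
  | Terminal b => Terminal b
  | Decision x lo hi => Decision x (f lo) (f hi)
  end.

Record bdd (V : finType) : Type := Bdd {
  node : finType;
  root : node;
  desc : node -> bdd_node V node }.

Definition child (V : finType) (B : bdd V) : rel (node B) := fun u v =>
  match desc u with
  | Terminal _ => false
  | Decision _ f t => (v == f) || (v == t)
  end.

Definition descendants (V : finType) (B : bdd V) (u : node B)
    : {set node B} :=
  [set v | connect (@child V B) u v].

Definition next (V : finType) (B : bdd V) (y : valuation V) (u : node B)
    : node B :=
  match desc u with
  | Terminal _ => u
  | Decision x f t => if y x then t else f
  end.

(* In an acyclic diagram every path reaches a terminal within #|node B|
   steps; the default value is never used. *)
Definition node_fun (V : finType) (B : bdd V) (u : node B) : bfun V := fun y =>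
  match desc (iter #|node B| (next y) u) with
  | Terminal b => b
  | Decision _ _ _ => false
  end.

Definition isomorphic_at (V : finType) (B : bdd V) (u v : node B) : Prop :=
  exists f : node B -> node B,
    [/\ {in descendants u &, injective f},
        f @: descendants u = descendants v,
        f u = v
      & forall w, w \in descendants u -> desc (f w) = map_children f (desc w)].

Definition ordered (V : finType) (lt : rel V) (B : bdd V) : Prop :=
  forall (u v : node B) x f t y f' t', child u v ->
    desc u = Decision x f t -> desc v = Decision y f' t' -> lt x y.

Definition reduced (V : finType) (B : bdd V) : Prop :=
  (forall (u : node B) x f t, desc u = Decision x f t -> f <> t) /\
  (forall u v : node B, isomorphic_at u v -> u = v).

(* [lt] is meant to be a strict total order on the variables. *)
Definition is_robdd (V : finType) (lt : rel V) (F : bfun V) (B : bdd V)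
    : Prop :=
  [/\ forall u : node B, u \in descendants (root B),
      ordered lt B,
      reduced B
    & node_fun (root B) =1 F].

Definition node_values (V : finType) (B : bdd V) (y : valuation V)
    : valuation (V + node B)%type :=
  [ffun w => match w with inl x => y x | inr u => node_fun u y end].

(* "At most k clauses per node" is read as a bound on the whole CNF. *)
Definition is_bdd_encoding (k : nat) (V : finType) (B : bdd V)
    (E : cnf (V + node B)%type) : Prop :=
  size E <= k * #|node B| /\
  forall y : valuation V, sat (node_values B y) E.

Definition is_consistent (V : finType) (F : bfun V) (B : bdd V)
    (E : cnf (V + node B)%type) : Prop :=
  forall A : {set lit V}, consistent_lits A ->
    (~~ extendable F A <-> up_produces E (inl_lits (node B) A) (inr (root B), false)).

(* The bound L is an integer, as it may be negative once a variable has been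
   fixed to true. *)
Definition pb (n : nat) (b : 'I_n -> nat) (L : int) : bfun 'I_n := fun x =>
  (Posz (\sum_(r < n) b r * x r)%N <= L)%R.

Definition max_coef (n : nat) (b : 'I_n -> nat) : nat := \max_(r < n) b r.
Definition top_bit (n : nat) (b : 'I_n -> nat) : nat :=
  trunc_log 2 (max_coef b).

(* Bit j of b, written delta_{j,r} for b = b_r. *)
Definition bit (j b : nat) : bool := odd (b %/ 2 ^ j).

(* The variables x_{j,r}, i.e. the pairs (j, r) with delta_{j,r} = 1. *)
Definition dvar (n : nat) (b : 'I_n -> nat) : finType :=
  {p : 'I_(top_bit b).+1 * 'I_n | bit p.1 (b p.2)}.

Definition dvar_lt (n : nat) (b : 'I_n -> nat) : rel (dvar b) := fun p q =>
  let: (j, r) := val p in let: (j', r') := val q in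
  (j < j') || ((j == j') && (r < r')).

Definition decomposed (n : nat) (b : 'I_n -> nat) (L : int) : bfun (dvar b) :=
  fun x => (Posz (\sum_(p : dvar b) 2 ^ (val p).1 * x p)%N <= L)%R.
Arguments decomposed {n} b L _.

Definition equality_clauses (n : nat) (b : 'I_n -> nat) (N : finType)
    : cnf ('I_n + (dvar b + N))%type :=
  flatten [seq [:: [:: (inr (inl p), false); (inl (val p).2, true)];
                   [:: (inr (inl p), true); (inl (val p).2, false)]]
          | p <- enum (dvar b)].

(* Encoding by coefficient decomposition, from a SAT encoding E of a BDD B of
   the decomposed constraint; the variable of the root is not forced. *)
Definition decomposition_cnf (n : nat) (b : 'I_n -> nat) (B : bdd (dvar b))
    (E : cnf (dvar b + node B)%type)
    : cnf ('I_n + (dvar b + node B))%type :=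
  rename inr E ++ equality_clauses b (node B).

(* C with x_i true, as a constraint on the other variables:
   the sum over r of a_(lift i r) x_(lift i r) is at most K - a_i. *)
Definition rest_coef (n : nat) (a : 'I_n -> nat) (i : 'I_n) : 'I_n.-1 -> nat :=
  fun r => a (lift i r).
Definition rest_bound (n : nat) (a : 'I_n -> nat) (K : nat) (i : 'I_n) : int :=
  (Posz K - Posz (a i))%R.

Section WholeEncoding.

Variables (n : nat) (a : 'I_n -> nat).
Variable B : forall i : 'I_n, bdd (dvar (rest_coef a i)).

Definition aux_at (i : 'I_n) : finType :=
  (dvar (rest_coef a i) + node (B i))%type.

(* Tagging by i keeps the auxiliary variables for distinct i disjoint. *)
Definition aux : finType := {i : 'I_n & aux_at i}.

Definition embed (i : 'I_n) (w : 'I_n.-1 + aux_at i) : 'I_n + aux :=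
  match w with
  | inl r => inl (lift i r)
  | inr z => inr (Tagged aux_at z)
  end.

Definition root_var (i : 'I_n) : 'I_n + aux :=
  embed (inr (inr (root (B i)) : aux_at i)).

Definition whole_cnf
    (E : forall i : 'I_n, cnf (dvar (rest_coef a i) + node (B i))%type)
    : cnf ('I_n + aux)%type :=
  flatten [seq [:: (root_var i, true); (inl i, false)]
               :: rename (@embed i) (decomposition_cnf (E i))
          | i <- enum 'I_n].

End WholeEncoding.

(* Main.v *)
Require Import Defs.
From mathcomp Require Import all_boot all_order all_algebra.
From mathcomp Require Import zify.
(* [root] and [next] are also names of MathComp; those of [Defs] are meant. *)
Import Defs.

Set Implicit Arguments.
Unset Strict Implicit.
Unset Printing Implicit Defensive.

(** Since [A] extends to a model of [S], every propagation run from [A] is sound,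
    so a maximal run is closed under unit propagation and absorbs the runs of each
    component encoding. If [A] with [x_i] true violates [C], then [A] transported
    to the variables [x_(j,r)] violates the decomposed [C_i], so consistency yields
    the negation of [r_i], and the binary clause the negation of [x_i].

    For the size, distinct nodes of an ROBDD represent distinct functions. A node
    with selector [(j, r)] represents the constraint left after fixing the smaller
    variables to a total weight [s]; the remaining weights are multiples of [2^j],
    so only a quotient by [2^j] of a shift of [s] matters. As [s <= 2 n 2^j],
    it takes [O(n)] values, whence [O(n^2 log a_M)] nodes in each of the [n]
    diagrams. *)

(** * Unit propagation *)

(** Unlike in [is_unit], the literal [l] need not be undefined, so closedness applies without first
    ruling out a conflict. *)
Definition unit_closed (V : finType) (S : cnf V) (B : {set lit V}) : Prop :=
  forall c l, c \in S -> l \in c ->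
  all (fun l' => (l' == l) || (neg l' \in B)) c -> l \in B.

Lemma extendsP (V : finType) (y : valuation V) (A : {set lit V}) :
  reflect (forall x b, (x, b) \in A -> y x = b) (extends y A).
Proof.
apply: (iffP forall_inP) => [h x b /h /eqP // | h [x b] xbA].
by apply/eqP/h.
Qed.

Lemma unit_true (V : finType) (y : valuation V) (B : {set lit V}) c l :
  extends y B -> has (fun l => y l.1 == l.2) c ->
  all (fun l' => (l' == l) || (neg l' \in B)) c -> y l.1 = l.2.
Proof.
move/extendsP=> yB /hasP[[x b] lc /= /eqP yx] /allP/(_ _ lc)/orP[/eqP <- //|].
by move/yB; rewrite yx; case: b {lc yx}.
Qed.

Lemma up_run_extends (V : finType) (S : cnf V) A B (y : valuation V) :
  sat y S -> extends y A -> up_run S A B -> extends y B.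
Proof.
move=> /allP yS yA; elim=> // {}B c [x b] _ yB cS /and4P[_ _ _ cl].
have /= yx := unit_true yB (yS _ cS) cl.
by apply/extendsP=> x' b'; rewrite !inE => /orP[/eqP[-> ->]|] //; apply/extendsP.
Qed.

Lemma up_run_sub (V : finType) (S : cnf V) A B : up_run S A B -> A \subset B.
Proof.
elim=> // {}B c l _ AB _ _; apply: subset_trans AB _; exact: subsetUr.
Qed.

(** Each step adds a new literal, so the complement of the assignment shrinks. *)
Lemma up_run_maximal (V : finType) (S : cnf V) (A : {set lit V}) :
  exists2 B, up_run S A B & forall c l, c \in S -> ~~ is_unit B c l.
Proof.
suff H B : up_run S A B ->
    exists2 B, up_run S A B & forall c l, c \in S -> ~~ is_unit B c l.
  exact: H (up_start S A).
have [m] := ubnP #|~: B|; elim: m B => // m IH B ltm run.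
have [/hasP[c cS /hasP[l lc u]]|/hasPn nu] :=
    boolP (has (fun c => has (is_unit B c) c) S); last first.
  exists B => // c l /nu/hasPn nul; apply/negP=> u.
  by have /and4P[lc _ _ _] := u; move: (nul _ lc); rewrite u.
rewrite ltnS in ltm; apply: IH (up_step run cS u); apply: leq_trans ltm.
apply: proper_card.
have /and4P[_ lB _ _] := u.
rewrite properE setCS subsetUr /=; apply/subsetPn; exists l; first by rewrite inE.
by rewrite !inE eqxx.
Qed.

(** The model [y] satisfies every literal of a maximal run and makes the last literal [l] of a unit
    clause true, so [neg l] is never present and a missing [l] would allow one more step. *)
Lemma up_closure (V : finType) (S : cnf V) A (y : valuation V) :
  sat y S -> extends y A ->
  exists B, [/\ up_run S A B, A \subset B & unit_closed S B].
Proof.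
move=> yS yA; have [B run max] := up_run_maximal S A.
exists B; split=> //; first exact: up_run_sub run.
move=> c l cS lc u; have yB := up_run_extends yS yA run.
have yl := unit_true yB (allP yS _ cS) u.
apply: contraNT (max c l cS) => lB; rewrite /is_unit lc lB u andbT /=.
by apply/negP=> /(extendsP _ _ yB); rewrite /= yl; case: (l.2).
Qed.

(** Whenever a clause fires in [E], all but one literal of its image in [S] are false in [B], so
    closedness supplies the last one. *)
Lemma up_run_rename (V W : finType) (f : V -> W) (E : cnf V) (S : cnf W) A D B :
  unit_closed S B -> {subset rename f E <= S} -> up_run E A D ->
  (forall l, l \in A -> rename_lit f l \in B) ->
  forall l, l \in D -> rename_lit f l \in B.
Proof.
move=> clB ES run AB; elim: run => // {}D c l _ DB cE /and4P[lc _ _ cl] l'.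
rewrite inE in_set1 => /predU1P[->|/DB //].
apply: (clB (map (rename_lit f) c)); [exact/ES/map_f|exact: map_f|].
rewrite all_map; apply/allP=> l1 /(allP cl)/= /orP[/eqP->|/DB nl1].
  by rewrite eqxx.
by apply/orP; right.
Qed.

(** * Ordered and reduced decision diagrams *)

Definition update (V : finType) (y : valuation V) (x : V) (b : bool)
    : valuation V := [ffun z => if z == x then b else y z].

Definition splice (V : finType) (D : pred V) (y z : valuation V)
    : valuation V := [ffun x => if D x then y x else z x].

Section OrderedDiagram.

Variables (V : finType) (lt : rel V) (B : bdd V).
Hypotheses (lt_irr : irreflexive lt) (lt_trans : transitive lt).
Hypothesis lt_total : forall x y, x != y -> lt x y || lt y x.
Hypothesis ordB : ordered lt B.

(** In an ordered diagram such an [x] is tested neither at [u] nor below it; at a terminal this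
    covers all variables. *)
Definition precedes (x : V) (u : node B) : bool :=
  if desc u is Decision y _ _ then lt x y else true.

Lemma precedes_child_selector u v x f t :
  child u v -> desc u = Decision x f t -> precedes x v.
Proof.
move=> uv du; rewrite /precedes; case dv: (desc v) => [//|y f' t'].
exact: ordB uv du dv.
Qed.

Lemma precedes_child x u v : child u v -> precedes x u -> precedes x v.
Proof.
move=> uv; rewrite {1}/precedes; case du: (desc u) => [b|y f t] xy.
  by move: uv; rewrite /child du.
have := precedes_child_selector uv du.
by rewrite /precedes; case: (desc v) => // z _ _; apply: lt_trans.
Qed.

Lemma precedes_descendant x u v :
  v \in descendants u -> precedes x u -> precedes x v.
Proof.
rewrite inE => /connectP[p + ->]; elim: p u => //= w p IH u /andP[uw wp] xu.
exact/IH/(precedes_child uw).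
Qed.

(** The selector of [u] precedes [v], hence every descendant of [v], but it does not precede [u]
    itself. *)
Lemma child_acyclic (u v : node B) : child u v -> u \notin descendants v.
Proof.
move=> uv; apply/negP=> vu; case du: (desc u) => [b|x f t].
  by move: uv; rewrite /child du.
have := precedes_descendant vu (precedes_child_selector uv du).
by rewrite /precedes du lt_irr.
Qed.

Lemma descendants_child (u v : node B) :
  child u v -> descendants v \subset descendants u.
Proof.
move=> uv; apply/subsetP=> w; rewrite !inE; apply: connect_trans.
exact: connect1.
Qed.

Lemma descendantsE (u w : node B) : w \in descendants u ->
  w = u \/ exists2 c, child u c & w \in descendants c.
Proof.
rewrite inE => /connectP[[|c p] /=]; first by left.
move=> /andP[uc cp] ->; right; exists c => //.
by rewrite inE; apply/connectP; exists p.
Qed.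

Lemma card_descendants_child (u v : node B) :
  child u v -> #|descendants v| < #|descendants u|.
Proof.
move=> uv; apply: proper_card; rewrite properE descendants_child //.
by apply/subsetPn; exists u; [rewrite inE connect0 | exact: child_acyclic].
Qed.

Lemma next_child y u x f t :
  desc u = Decision x f t -> child u (@next V B y u).
Proof. by move=> du; rewrite /child /next du; case: ifP; rewrite eqxx ?orbT. Qed.

(** A step to a child strictly lowers the number of descendants, which is at most [#|node B|] and
    always positive. *)
Lemma iter_next_terminal y (u : node B) :
  exists b, desc (iter #|node B| (next y) u) = Terminal b.
Proof.
suff H k : (exists b, desc (iter k (next y) u) = Terminal b) \/
           #|descendants (iter k (next y) u)| + k <= #|descendants u|.
  case: (H #|node B|) => // le.
  have : 0 < #|descendants (iter #|node B| (next y) u)|.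
    by apply/card_gt0P; exists (iter #|node B| (next y) u); rewrite inE connect0.
  have : #|descendants u| <= #|node B| := max_card _.
  by lia.
elim: k => [|k [[b IH]|IH]]; first by right; rewrite addn0.
  by left; exists b; rewrite iterS /next IH.
case dk: (desc (iter k (next y) u)) => [b|x f t].
  by left; exists b; rewrite iterS /next dk.
have := card_descendants_child (next_child y dk).
by right; rewrite iterS; lia.
Qed.

Lemma node_fun_terminal (u : node B) b y : desc u = Terminal b -> node_fun u y = b.
Proof.
move=> du; have it k : iter k (next y) u = u.
  by elim: k => // k IH; rewrite iterS IH /next du.
by rewrite /node_fun it du.
Qed.

Lemma node_fun_next (u : node B) y : node_fun (next y u) y = node_fun u y.
Proof.
rewrite /node_fun -iterSr iterS; have [b db] := iter_next_terminal y u.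
by rewrite {1 2}/next db db.
Qed.

Lemma node_fun_agree (u : node B) (y z : valuation V) :
  (forall x, ~~ precedes x u -> y x = z x) -> node_fun u y = node_fun u z.
Proof.
have [m] := ubnP #|descendants u|; elim: m u => // m IH u ltm yz.
case du: (desc u) => [b|x f t]; first by rewrite !(node_fun_terminal _ du).
rewrite -[LHS]node_fun_next -[RHS]node_fun_next.
have -> : next y u = next z u.
  by rewrite /next du yz // /precedes du lt_irr.
have ch := next_child z du.
apply: IH => [|q]; first by have := card_descendants_child ch; lia.
by move=> /(contra (precedes_child ch)) /yz.
Qed.

(** The children represent the two cofactors in the selector, because the selector is not tested
    below [u]. *)
Lemma node_fun_update (u : node B) x f t y b : desc u = Decision x f t ->
  node_fun u (update y x b) = node_fun (if b then t else f) y.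
Proof.
move=> du; rewrite -node_fun_next.
have nx : next (update y x b) u = if b then t else f.
  by rewrite /next du ffunE eqxx.
rewrite nx; apply: node_fun_agree => q nq; rewrite ffunE.
case: eqP nq => // -> /negP[]; apply: (precedes_child_selector _ du).
by rewrite -nx; apply: next_child du.
Qed.

(** * Reduced diagrams: nodes as functions, and a bound on their number *)

Hypothesis redB : reduced B.

(** Sending [u] to [v] and fixing all other nodes is an isomorphism: by acyclicity neither [u] nor
    [v] lies below their common children. *)
Lemma desc_inj : injective (@desc V B).
Proof.
move=> u v duv; apply: (proj2 redB).
have chE w : child u w = child v w by rewrite /child duv.
pose g w := if w == u then v else w.
have gid w : w != u -> g w = w by rewrite /g => /negbTE ->.
have vu w : w \in descendants u -> w != u -> w != v.
  move=> /descendantsE[->|[c uc wc]]; first by rewrite eqxx.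
  by move=> _; apply: contraTneq wc => ->; apply: child_acyclic; rewrite -chE.
have cu w c : w \in descendants u -> child w c -> c != u.
  move=> wu wc; apply: contraTneq wu => <-; exact: child_acyclic.
exists g; split.
- move=> w w' wu w'u; rewrite /g; case: eqP => [->|/eqP nw]; case: eqP => //.
    by move=> /eqP nw' vw'; move: (vu _ w'u nw'); rewrite -vw' eqxx.
  by move=> _ wv; move: (vu _ wu nw); rewrite wv eqxx.
- apply/setP=> w; apply/imsetP/idP.
    case=> w' /descendantsE[-> ->|[c uc w'c ->]].
      by rewrite /g eqxx inE connect0.
    rewrite gid; first by apply: subsetP w'c; apply: descendants_child; rewrite -chE.
    by apply: contraTneq w'c => ->; exact: child_acyclic.
  case/descendantsE=> [->|[c vc wc]].
    by exists u; rewrite ?inE ?connect0 // /g eqxx.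
  rewrite -chE in vc; exists w; first exact: subsetP (descendants_child vc) _ wc.
  by rewrite gid //; apply: contraTneq wc => ->; exact: child_acyclic.
- by rewrite /g eqxx.
- move=> w wu; have -> : desc (g w) = desc w.
    by rewrite /g; case: eqP => // ->.
  case dw: (desc w) => [//|x f t] /=.
  by rewrite !gid //; apply: (cu w) => //; rewrite /child dw eqxx ?orbT.
Qed.

(** Induction on the larger subdiagram. If the selector of one node precedes the other node, both
    its cofactors agree, so its children coincide by induction, against reducedness. With equal
    selectors the cofactors, hence the children, agree pairwise, and [desc_inj] applies. *)
Lemma node_fun_inj (u v : node B) : node_fun u =1 node_fun v -> u = v.
Proof.
have [m] := ubnP (maxn #|descendants u| #|descendants v|).
elim: m u v => // m IH u v ltm uv.
have childs (w : node B) x f t : desc w = Decision x f t ->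
    [/\ child w f & child w t] by rewrite /child => ->; rewrite !eqxx orbT.
(* The smaller of two distinct selectors is redundant. *)
have redundant (w w' : node B) x f t : #|descendants w| <= m ->
    node_fun w =1 node_fun w' ->
    desc w = Decision x f t -> ~~ precedes x w'.
  move=> lw ww' dw; apply/negP=> xw'; have [ft _] := redB; apply: (ft _ _ _ _ dw).
  have [wf wt] := childs _ _ _ _ dw.
  apply: IH => [|y].
    by have := card_descendants_child wf; have := card_descendants_child wt; lia.
  rewrite -(node_fun_update y false dw) -(node_fun_update y true dw) !ww'.
  by apply: node_fun_agree => q; rewrite !ffunE; case: eqP => // ->; rewrite xw'.
have [lu lv] : #|descendants u| <= m /\ #|descendants v| <= m by split; lia.
have vu : node_fun v =1 node_fun u by move=> y.
apply: desc_inj; case du: (desc u) => [b|x f t].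
  case dv: (desc v) => [b'|x' f' t'].
    pose y : valuation V := [ffun=> false].
    by rewrite -(node_fun_terminal y du) uv (node_fun_terminal y dv).
  by have := redundant _ _ _ _ _ lv vu dv; rewrite /precedes du.
have := redundant _ _ _ _ _ lu uv du; rewrite /precedes.
case dv: (desc v) => [//|x' f' t'] nxx'.
have := redundant _ _ _ _ _ lv vu dv; rewrite /precedes du => nx'x.
have xx' : x = x'.
  by apply/eqP; apply: contraT => /lt_total; rewrite (negbTE nxx') (negbTE nx'x).
rewrite -xx' in dv *.
have [uf ut] := childs _ _ _ _ du; have [vf vt] := childs _ _ _ _ dv.
move: {+}uf {+}ut {+}vf {+}vt.
do 4 move/card_descendants_child => ?.
congr Decision; apply: IH => [|y]; try lia.
  by rewrite -(node_fun_update y false du) -(node_fun_update y false dv) uv.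
by rewrite -(node_fun_update y true du) -(node_fun_update y true dv) uv.
Qed.

(** The assignment [y] records the branches along a path from the root to [u]; any assignment that
    agrees with [y] before [u] follows this path. *)
Lemma node_fun_splice (u : node B) : u \in descendants (root B) ->
  exists y : valuation V, forall z,
    node_fun u z = node_fun (root B) (splice (precedes^~ u) y z).
Proof.
suff H : u \in descendants (root B) -> exists y : valuation V, forall z : valuation V,
    (forall x, precedes x u -> z x = y x) -> node_fun u z = node_fun (root B) z.
  move=> /H[y Hy]; exists y => z; rewrite -Hy => [|x xu]; last by rewrite ffunE xu.
  by apply: node_fun_agree => x /negbTE nx; rewrite ffunE nx.
rewrite inE => /connectP[p]; elim/last_ind: p u => [|p v IH] u /=.
  by move=> _ ->; exists [ffun=> false].
rewrite rcons_path last_rcons => /andP[/IH/(_ erefl)[y Hy] ch ->].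
case du: (desc (last (root B) p)) => [b|x f t].
  by move: ch; rewrite /child du.
(* The path is prolonged by one edge: the selector of its last node is set to the branch that leads
   to [v]. *)
exists (update y x (v == t)) => z Hz.
have xv := precedes_child_selector ch du.
have <- : next z (last (root B) p) = v.
  rewrite /next du Hz // ffunE eqxx; move: ch; rewrite /child du.
  by case: (v =P t) => [->|_] //; rewrite orbF => /eqP.
rewrite node_fun_next; apply: Hy => q qu.
rewrite Hz; last exact: precedes_child qu.
by rewrite ffunE; case: eqP qu => // ->; rewrite /precedes du lt_irr.
Qed.

(** Here [key p] sorts the assignments to the variables before [p] into [k] classes, each
    determining the remaining function. A decision node is coded by its selector and the class of an
    assignment leading to it; the summand 2 counts the terminals. *)
Lemma robdd_card k (key : V -> valuation V -> 'I_k) :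
  (forall u : node B, u \in descendants (root B)) ->
  (forall p y y', key p y = key p y' -> forall z,
     node_fun (root B) (splice (lt^~ p) y z) =
     node_fun (root B) (splice (lt^~ p) y' z)) ->
  #|node B| <= 2 + #|V| * k.
Proof.
move=> reach keyP.
have [y Hy] := fin_all_exists (fun u => node_fun_splice (reach u)).
pose code u : bool + V * 'I_k :=
  match desc u with
  | Terminal b => inl b
  | Decision p _ _ => inr (p, key p (y u))
  end.
suff /leq_card : injective code.
  by rewrite card_sum card_bool card_prod card_ord.
move=> u v; rewrite /code.
case du: (desc u) => [b|p f t]; case dv: (desc v) => [b'|p' f' t'] //.
  by case=> bb'; apply: desc_inj; rewrite du dv bb'.
case=> pp'; rewrite -pp' in dv * => kk; apply: node_fun_inj => z.
have spl (w : node B) q g h s : desc w = Decision q g h ->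
    splice (precedes^~ w) s z = splice (lt^~ q) s z.
  by move=> dw; apply/ffunP=> x; rewrite !ffunE /precedes dw.
by rewrite (Hy u z) (Hy v z) (spl _ _ _ _ _ du) (spl _ _ _ _ _ dv); apply: keyP.
Qed.

End OrderedDiagram.

(** * Coefficient decomposition *)

Lemma modn_bits (b m : nat) : b %% 2 ^ m = \sum_(j < m) bit j b * 2 ^ j.
Proof.
elim: m => [|m IH]; first by rewrite big_ord0 modn1.
rewrite big_ord_recr /= -IH /bit.
have pos : 0 < 2 ^ m by rewrite expn_gt0.
have lt := ltn_pmod b pos.
rewrite {1}(divn_eq b (2 ^ m)) -{1}(odd_double_half (b %/ 2 ^ m)).
set q := b %/ 2 ^ m; set r := b %% 2 ^ m in lt *.
rewrite -[X in (_ + X) * _]muln2 mulnDl -mulnA -expnS.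
rewrite -addnA addnCA modnMDl addnC modn_small // expnS.
by case: (odd q); lia.
Qed.

Lemma sum_pow2 m : \sum_(j < m) 2 ^ j = (2 ^ m).-1.
Proof. by elim: m => [|m IH]; rewrite ?big_ord0 // big_ord_recr /= IH expnS; lia. Qed.

Lemma sum_dvar (n : nat) (b : 'I_n -> nat) (F : 'I_(top_bit b).+1 * 'I_n -> nat) :
  \sum_(p : dvar b) F (val p) =
    \sum_(p : 'I_(top_bit b).+1 * 'I_n | bit p.1 (b p.2)) F p.
Proof.
rewrite [RHS](reindex_omap (val : dvar b -> _) insub) /=.
  by apply: eq_bigl => -[p bp] /=; rewrite bp insubT /= eqxx.
by move=> p bp; rewrite insubT.
Qed.

Lemma coef_lt_top_bit (n : nat) (b : 'I_n -> nat) r : b r < 2 ^ (top_bit b).+1.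
Proof.
apply: leq_ltn_trans (trunc_log_ltn _ _) => //.
by rewrite /max_coef; apply: (leq_bigmax r).
Qed.

Lemma sum_decomposed (n : nat) (b g : 'I_n -> nat) :
  \sum_(p : dvar b) 2 ^ (val p).1 * g (val p).2 = \sum_(r < n) b r * g r.
Proof.
rewrite (sum_dvar (fun p => 2 ^ p.1 * g p.2)) big_mkcond /=.
rewrite -(pair_bigA _ (fun (j : 'I_(top_bit b).+1) (r : 'I_n) =>
  if bit j (b r) then 2 ^ j * g r else 0)) /=.
rewrite exchange_big /=; apply: eq_bigr => r _.
(* Reduction modulo [2 ^ (top_bit b).+1] leaves [b r] unchanged and turns it into the sum of its
   bits. *)
rewrite -[in RHS](modn_small (coef_lt_top_bit b r)) modn_bits big_distrl /=.
by apply: eq_bigr => j _; case: bit; rewrite ?mul1n.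
Qed.

Lemma card_dvar (n : nat) (b : 'I_n -> nat) : #|dvar b| <= (top_bit b).+1 * n.
Proof.
rewrite card_sub; apply: leq_trans (max_card _) _.
by rewrite card_prod !card_ord.
Qed.

Section DvarOrder.

Variables (n : nat) (b : 'I_n -> nat).

Lemma dvar_lt_irr : irreflexive (@dvar_lt n b).
Proof. by case=> [[j r] p]; rewrite /dvar_lt /= eqxx !ltnn. Qed.

Lemma dvar_lt_trans : transitive (@dvar_lt n b).
Proof.
case=> [[j r] p] [[j' r'] p'] [[j'' r''] p'']; rewrite /dvar_lt /=.
by rewrite -!val_eqE /=; lia.
Qed.

Lemma dvar_lt_total (p q : dvar b) : p != q -> dvar_lt p q || dvar_lt q p.
Proof.
case: p q => [[j r] p] [[j' r'] q]; rewrite /dvar_lt -!val_eqE /= xpair_eqE.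
by rewrite -!val_eqE /=; lia.
Qed.

End DvarOrder.

(* [L = lam * d + rho] is the Euclidean division, and [e = d - 1 - rho]. *)
Lemma threshold_quotient (d : nat) (L : int) : 0 < d ->
  exists e lam, e < d /\ forall s t,
    (Posz (d * t + s) <= L)%R = (Posz (t + (s + e) %/ d) <= lam)%R.
Proof.
move=> d0; have := divz_eq L d.
have := ltz_pmod L (d0 : (0 < Posz d)%R).
have : (0 <= L %% d)%Z%R by apply: modz_ge0; lia.
move: (L %% d)%Z (L %/ d)%Z => rho lam rho0 rhod Leq.
have {rho0 rhod} [e ed ee] : exists2 e, e < d & (Posz e = Posz d - 1 - rho)%R.
  by exists (absz (Posz d - 1 - rho)%R); lia.
exists e, lam; split=> // s t.
have := divn_eq (s + e) d; have := ltn_pmod (s + e) d0.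
move: (_ %/ _) (_ %% _) => q r rd sq.
(* [(s + e) %/ d] is the quotient of [s - rho] by [d] rounded up, the least amount by which [lam]
   has to exceed [t]. *)
by apply/idP/idP; nia.
Qed.

(** * Size of the ROBDD of a decomposed constraint *)

Section DecomposedRobdd.

Variables (n : nat) (b : 'I_n -> nat) (L : int).

Definition weight_below (p : dvar b) (y : valuation (dvar b)) : nat :=
  \sum_(q : dvar b | dvar_lt q p) 2 ^ (val q).1 * y q.

(* At most [n] variables carry each coefficient [2 ^ j'] with [j' <= j]. *)
Lemma weight_below_le (p : dvar b) y :
  weight_below p y <= n * 2 ^ (val p).1.+1.
Proof.
set j := (val p).1; rewrite /weight_below.
apply: leq_trans (_ :
  \sum_(q : dvar b) (if (val q).1 <= j then 2 ^ (val q).1 else 0) <= _).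
  rewrite big_mkcond; apply: leq_sum => q _.
  rewrite /j /dvar_lt; case: (val q) (val p) => [jq rq] [jp rp] /=.
  case: ifP => // /orP[/ltnW ->|/andP[/eqP -> _]].
    by case: (y q); rewrite ?muln1 ?muln0.
  by rewrite leqnn; case: (y q); rewrite ?muln1 ?muln0.
rewrite (sum_dvar (fun p => if p.1 <= j then 2 ^ p.1 else 0)) big_mkcond /=.
apply: leq_trans (_ :
  \sum_(q : 'I_(top_bit b).+1 * 'I_n) (if q.1 <= j then 2 ^ q.1 else 0) <= _).
  by apply: leq_sum => q _; case: (bit _ _).
rewrite -(pair_bigA _ (fun (j' : 'I_(top_bit b).+1) (_ : 'I_n) =>
  if j' <= j then 2 ^ j' else 0)) /=.
rewrite exchange_big /= sum_nat_const card_ord leq_mul2l; apply/orP; right.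
rewrite -big_mkcond /=.
rewrite -(big_ord_widen (top_bit b).+1 (fun i => 2 ^ i) (ltn_ord j)) sum_pow2.
exact: leq_pred.
Qed.

(** From [p] on, all coefficients are multiples of the power of two at [p], so it factors out and
    leaves a weight [t z] that does not depend on [y]. *)
Lemma decomposed_splice (p : dvar b) : exists t : valuation (dvar b) -> nat,
  forall y z, decomposed b L (splice (@dvar_lt n b ^~ p) y z) =
    (Posz (2 ^ (val p).1 * t z + weight_below p y) <= L)%R.
Proof.
exists (fun z : valuation (dvar b) =>
  \sum_(q : dvar b | ~~ dvar_lt q p) 2 ^ ((val q).1 - (val p).1) * z q).
move=> y z; rewrite /decomposed (bigID (@dvar_lt n b ^~ p)) /= addnC.
rewrite big_distrr /=; congr (Posz (_ + _) <= _)%R; last first.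
  by apply: eq_bigr => q qp; rewrite ffunE qp.
apply: eq_bigr => q qp; rewrite ffunE (negbTE qp) mulnA -expnD subnKC //.
case: p q qp => [[jp rp] pp] [[jq rq] qq]; rewrite /dvar_lt /=.
by rewrite negb_or -leqNgt => /andP[].
Qed.

Lemma decomposed_robdd_card (B : bdd (dvar b)) :
  is_robdd (@dvar_lt n b) (decomposed b L) B ->
  #|node B| <= 2 + #|dvar b| * (2 * n).+1.
Proof.
case=> reach ordB redB rootF.
have pos (p : dvar b) : 0 < 2 ^ (val p).1 by rewrite expn_gt0.
have [e He] := fin_all_exists (fun p => threshold_quotient L (pos p)).
(* With [d] the power of two at [p], the weight is at most [2 * n * d] and [e p < d], so the
   quotient is at most [2 * n] and [inord] never falls back on its default. *)
pose key (p : dvar b) y : 'I_(2 * n).+1 :=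
  inord ((weight_below p y + e p) %/ 2 ^ (val p).1).
apply: (robdd_card (@dvar_lt_irr n b) (@dvar_lt_trans n b) (@dvar_lt_total n b)
  ordB redB (key := key) reach) => p y y' kk z.
have [t Ht] := decomposed_splice p; have [lam [ep Hlam]] := He p.
rewrite !rootF !Ht !Hlam; congr (Posz (_ + _) <= _)%R.
have small x : (weight_below p x + e p) %/ 2 ^ (val p).1 < (2 * n).+1.
  rewrite ltn_divLR ?expn_gt0 //; have := weight_below_le p x.
  by rewrite expnS; move: ep; move: (2 ^ _) => d; nia.
by have := congr1 (@nat_of_ord _) kk; rewrite /key !inordK; try exact: small.
Qed.

End DecomposedRobdd.

(** * The encoding of the whole constraint *)

Lemma sat_rename (V W : finType) (f : V -> W) (S : cnf V) (y : valuation W) :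
  sat y (rename f S) = sat [ffun v => y (f v)] S.
Proof.
rewrite /sat /rename all_map; apply: eq_all => c /=; rewrite has_map.
by apply: eq_has => l /=; rewrite ffunE.
Qed.

Lemma sat_cat (V : finType) (y : valuation V) (S T : cnf V) :
  sat y (S ++ T) = sat y S && sat y T.
Proof. exact: all_cat. Qed.

Lemma sat_flatten (V : finType) (y : valuation V) (Ss : seq (cnf V)) :
  sat y (flatten Ss) = all (sat y) Ss.
Proof. by elim: Ss => //= S Ss IH; rewrite sat_cat IH. Qed.

Lemma mem_rename (V W : finType) (f : V -> W) (S : cnf V) c :
  c \in S -> map (rename_lit f) c \in rename f S.
Proof. exact: map_f. Qed.

Lemma inl_litsP (V X : finType) (A : {set lit V}) (v : V) b :
  ((inl v, b) \in inl_lits X A) = ((v, b) \in A).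
Proof.
apply/imsetP/idP => [[[v' b'] vA [-> ->]] //|vA].
by exists (v, b).
Qed.

Lemma extends_inl_lits (V X : finType) (A : {set lit V})
    (y : valuation (V + X)%type) (z : valuation V) :
  (forall v, y (inl v) = z v) -> extends z A -> extends y (inl_lits X A).
Proof.
move=> yz /extendsP zA; apply/extendsP => w b /imsetP[[v b'] vA [-> ->]].
by rewrite yz; apply: zA.
Qed.

Definition lift_dvar (n : nat) (b : 'I_n -> nat) (x : valuation 'I_n)
    : valuation (dvar b) := [ffun p => x (val p).2].

Lemma decomposed_lift (n : nat) (b : 'I_n -> nat) L x :
  decomposed b L (lift_dvar b x) = pb b L x.
Proof.
rewrite /decomposed /pb -(sum_decomposed b (fun r => nat_of_bool (x r))).
by congr (Posz _ <= _)%R; apply: eq_bigr => p _; rewrite ffunE.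
Qed.

Lemma decomposed_mono (n : nat) (b : 'I_n -> nat) L (y z : valuation (dvar b)) :
  (forall p, y p -> z p) -> decomposed b L z -> decomposed b L y.
Proof.
move=> yz; rewrite /decomposed; apply: Order.POrderTheory.le_trans.
rewrite lez_nat; apply: leq_sum => p _; rewrite leq_mul2l.
by have := yz p; case: (y p) => [->|_] //; rewrite orbT.
Qed.

Definition drop_var (n : nat) (i : 'I_n) (x : valuation 'I_n)
    : valuation 'I_n.-1 := [ffun r => x (lift i r)].

Lemma pb_drop (n : nat) (a : 'I_n -> nat) K (i : 'I_n) (x : valuation 'I_n) :
  x i -> pb a (Posz K) x =
    pb (rest_coef a i) (rest_bound a K i) (drop_var i x).
Proof.
move=> xi; rewrite /pb (bigD1_ord i) //= xi muln1 /rest_bound /rest_coef.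
set s := (\sum_(r < n.-1) _)%N.
have -> : (\sum_(r < n.-1) a (lift i r) * drop_var i x r)%N = s.
  by apply: eq_bigr => r _; rewrite ffunE.
by apply/idP/idP; lia.
Qed.

Lemma sat_equality_clauses (n : nat) (b : 'I_n -> nat) (N : finType)
    (y : valuation ('I_n + (dvar b + N))%type) :
  reflect (forall p, y (inr (inl p)) = y (inl (val p).2))
    (sat y (equality_clauses b N)).
Proof.
rewrite /equality_clauses sat_flatten all_map.
apply: (iffP allP) => [h p|h p _] /=.
  have := h p (mem_enum _ p) => /=.
  by case: (y (inr (inl p))); case: (y (inl (val p).2)).
by rewrite h; case: (y (inl (val p).2)).
Qed.

Section WholeEncoding.

Variables (n : nat) (a : 'I_n -> nat) (K : nat).
Variable B : forall i : 'I_n, bdd (dvar (rest_coef a i)).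
Variable E : forall i : 'I_n, cnf (dvar (rest_coef a i) + node (B i))%type.

Notation aux_var i z := (@embed n a B i (inr z)).

Lemma sat_whole_cnf (y : valuation ('I_n + aux B)%type) :
  reflect (forall i,
      [/\ y (inl i) -> y (root_var B i),
          sat [ffun z => y (aux_var i z)] (E i)
        & forall p, y (aux_var i (inl p)) = y (inl (lift i (val p).2))])
    (sat y (whole_cnf E)).
Proof.
have step i :
    reflect [/\ y (inl i) -> y (root_var B i),
          sat [ffun z => y (aux_var i z)] (E i)
        & forall p, y (aux_var i (inl p)) = y (inl (lift i (val p).2))]
      (sat y ([:: (root_var B i, true); (inl i, false)]
         :: rename (@embed n a B i) (decomposition_cnf (E i)))).
  rewrite -cat1s sat_cat !sat_rename sat_cat sat_rename.
  rewrite [sat y _]/= /sat /= andbT orbF -!/(sat _ _).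
  have -> : [ffun v => [ffun w => y (embed w)] (inr v)]
          = [ffun z => y (aux_var i z)] :> valuation (aux_at B i).
    by apply/ffunP=> z; rewrite !ffunE.
  apply: (iffP and3P) => [[h1 h2 h3]|[h1 h2 h3]]; split=> //.
  - by move: h1; case: (y (inl i)) => //; rewrite orbF eqb_id.
  - by move=> p; have /sat_equality_clauses/(_ p) := h3; rewrite !ffunE.
  - by move: h1; case: (y (inl i)); rewrite ?orbT // eqb_id => ->.
  - by apply/sat_equality_clauses => p; rewrite !ffunE; apply: h3.
rewrite /whole_cnf sat_flatten all_map.
apply: (iffP allP) => h i; first by apply/step/h; rewrite mem_enum.
by move=> _; apply/step.
Qed.

Lemma mem_whole_cnf i c :
  c \in [:: (root_var B i, true); (inl i, false)]
         :: rename (@embed n a B i) (decomposition_cnf (E i)) ->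
  c \in whole_cnf E.
Proof. by move=> ci; apply/flatten_mapP; exists i; rewrite ?mem_enum. Qed.

Lemma unit_closed_dvar (S : {set lit ('I_n + aux B)%type}) i p b :
  unit_closed (whole_cnf E) S -> (inl (lift i (val p).2), b) \in S ->
  (aux_var i (inl p), b) \in S.
Proof.
move=> clS pS.
(* The equality clause that is propagated: of the two for [p], the one containing the copy of the
   variable with sign [b]. *)
pose c : clause ('I_n.-1 + aux_at B i)%type :=
  [:: (inr (inl p), b); (inl (val p).2, ~~ b)].
apply: (clS (map (rename_lit (@embed n a B i)) c)).
- apply: (@mem_whole_cnf i); rewrite inE; apply/orP; right; apply: mem_rename.
  rewrite mem_cat; apply/orP; right; apply/flatten_mapP.
  by exists p; rewrite ?mem_enum // /c; case: (b); rewrite !inE eqxx ?orbT.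
- by rewrite inE eqxx.
- by rewrite /= eqxx /neg /= negbK pS.
Qed.

Lemma subset_rename_whole_cnf i :
  {subset rename (fun z => aux_var i z) (E i) <= whole_cnf E}.
Proof.
move=> _ /mapP[c cE ->]; apply: (@mem_whole_cnf i); rewrite inE; apply/orP; right.
have -> : map (rename_lit (fun z => aux_var i z)) c =
    map (rename_lit (@embed n a B i)) (map (rename_lit inr) c).
  by rewrite -map_comp.
by apply: mem_rename; rewrite mem_cat mem_rename.
Qed.

(** The canonical extension of [x]: the [x_(j,r)] copy [x_r], and node variables take the values of
    their functions, for which a SAT encoding is satisfied by definition. *)
Definition whole_model (x : valuation 'I_n) : valuation ('I_n + aux B)%type :=
  [ffun w => match w with
    | inl r => x r
    | inr z => node_values (B (tag z))
                 (lift_dvar (rest_coef a (tag z)) (drop_var (tag z) x)) (tagged z)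
    end].

Hypothesis robddB : forall i, is_robdd (@dvar_lt _ (rest_coef a i))
  (decomposed (rest_coef a i) (rest_bound a K i)) (B i).
Variable k : nat.
Hypothesis encE : forall i, is_bdd_encoding k (E i).
Hypothesis consE : forall i,
  is_consistent (decomposed (rest_coef a i) (rest_bound a K i)) (E i).

(** The binary clause holds because, when [x_i] is true, the root of the [i]-th diagram evaluates to
    [C] at [x]. *)
Lemma sat_whole_model x : pb a (Posz K) x -> sat (whole_model x) (whole_cnf E).
Proof.
move=> Cx; apply/sat_whole_cnf => i; split.
- rewrite !ffunE /= => xi; have [_ _ _ rootF] := robddB i.
  by rewrite ffunE rootF decomposed_lift -pb_drop.
- set y := (X in sat X _).
  suff -> : y = node_values (B i) (lift_dvar (rest_coef a i) (drop_var i x)).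
    exact: (proj2 (encE i)).
  by apply/ffunP=> z; rewrite !ffunE /= ffunE.
- by move=> p; rewrite !ffunE /= !ffunE.
Qed.

(** Conversely, suppose a model of the clauses violates [C]. Some [x_i] is then true, and the total
    assignment it induces on the copies violates the decomposed [C_i]. Consistency derives the
    negation of [r_i], which soundness of propagation makes true in the model, against the binary
    clause. *)
Lemma whole_encoding : is_encoding (pb a (Posz K)) (whole_cnf E).
Proof.
move=> x; split=> [Cx|[y yS ->{x}]].
  exists (whole_model x); first exact: sat_whole_model.
  by apply/ffunP=> r; rewrite !ffunE.
set x := [ffun r => _].
have [/existsP[i xi]|/existsPn x0] := boolP [exists i, x i]; last first.
  by rewrite /pb big1 // => r _; rewrite (negbTE (x0 r)) muln0.
apply: contraT; rewrite (pb_drop a K xi) -decomposed_lift.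
set z := lift_dvar _ _ => nCz.
have /sat_whole_cnf/(_ i)[rooti satE eqs] := yS.
pose A : {set lit (dvar (rest_coef a i))} := [set l | z l.1 == l.2].
have cA : consistent_lits A.
  by apply/forall_inP=> l; rewrite !inE /= => /eqP ->; case: (l.2).
have /(consE cA)[S run rS] :
    ~~ extendable (decomposed (rest_coef a i) (rest_bound a K i)) A.
  apply/existsPn=> z'; apply/negP=> /andP[Cz' /extendsP z'A].
  case/negP: nCz; suff -> : z = z' by [].
  by apply/ffunP=> p; apply/esym/z'A; rewrite inE.
have zA : extends [ffun v => y (aux_var i v)] (inl_lits (node (B i)) A).
  apply: (@extends_inl_lits _ _ _ _ z) => [p|].
    by rewrite ffunE eqs !ffunE.
  by apply/extendsP=> p b; rewrite inE => /eqP.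
have /extendsP/(_ _ _ rS) := up_run_extends satE zA run.
by rewrite ffunE; move: xi rooti; rewrite ffunE => -> /(_ isT) ->.
Qed.

Lemma whole_GAC : propagates_GAC (pb a (Posz K)) (whole_cnf E).
Proof.
move=> A consA /existsP[x /andP[Cx xA]] i nexti.
(* Otherwise [A] together with [x_i] true is still consistent, as the assignment [y] below
   requires. *)
have [iA|iA] := boolP ((i, false) \in A).
  by exists (inl_lits _ A); [exact: up_start | rewrite inl_litsP].
have yA : extends (whole_model x) (inl_lits (aux B) A).
  by apply: extends_inl_lits xA => v; rewrite ffunE.
have [S [run AS clS]] := up_closure (sat_whole_model Cx) yA.
exists S => //.
pose Ai : {set lit (dvar (rest_coef a i))} :=
  [set l | (lift i (val l.1).2, l.2) \in A].
have consAi : consistent_lits Ai.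
  by apply/forall_inP=> l; rewrite !inE => /(forall_inP consA).
have /(consE consAi)[D runD rootD] :
    ~~ extendable (decomposed (rest_coef a i) (rest_bound a K i)) Ai.
  apply: contra nexti => /existsP[z /andP[Cz /extendsP zA]].
  (* Besides [i], only the variables forced by [A] are set to true. *)
  pose y : valuation 'I_n := [ffun r => (r == i) || ((r, true) \in A)].
  apply/existsP; exists y; apply/andP; split.
    rewrite (@pb_drop _ _ _ i) ?ffunE ?eqxx // -decomposed_lift.
    (* [z] may give different values to copies of the same variable; monotonicity suffices, as every
       copy that [y] makes true is forced by [A] and so true in [z]. *)
    apply: decomposed_mono Cz => p.
    rewrite !ffunE eq_sym (negbTE (neq_lift _ _)) /= => pA.
    by rewrite (zA p true) // inE.
  apply/extendsP=> r b; rewrite inE in_set1 ffunE => /orP[/eqP[-> ->]|rA].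
    by rewrite eqxx.
  case: b rA => rA; first by rewrite rA orbT.
  have /negbTE := forall_inP consA _ rA; rewrite /neg /= => ->.
  by rewrite orbF; apply: contraNF iA => /eqP <-.
(* The equality clauses carry [A] over to [Ai] inside [S], after which [S] absorbs the run that
   derives the negated root. *)
have rootS : (root_var B i, false) \in S.
  apply: (up_run_rename clS (@subset_rename_whole_cnf i) runD _ rootD) => l.
  move=> /imsetP[[p b] pA ->]; apply: unit_closed_dvar => //.
  by apply: (subsetP AS); rewrite inl_litsP; rewrite inE in pA.
apply: (clS [:: (root_var B i, true); (inl i, false)]).
- by apply: (@mem_whole_cnf i); rewrite mem_head.
- by rewrite !inE eqxx orbT.
- by rewrite /= [neg _]/= rootS eqxx.
Qed.

(** * Counting clauses and auxiliary variables *)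

Lemma size_whole_cnf :
  size (whole_cnf E) = \sum_i (size (E i) + 2 * #|dvar (rest_coef a i)|).+1.
Proof.
rewrite /whole_cnf size_flatten /shape -map_comp sumnE big_map big_enum /=.
apply: eq_bigr => i _; rewrite size_map size_cat size_map; congr (_ + _).+1.
rewrite /equality_clauses size_flatten /shape -map_comp sumnE big_map big_enum /=.
by rewrite sum_nat_const mulnC.
Qed.

Lemma card_aux : #|aux B| = \sum_i (#|dvar (rest_coef a i)| + #|node (B i)|).
Proof.
rewrite card_tagged sumnE big_map big_enum /=.
by apply: eq_bigr => i _; rewrite card_sum.
Qed.

(** The maximum with 1 keeps the bound positive when the logarithm vanishes, as for unit
    coefficients. *)
Let ell := maxn 1 (trunc_log 2 (max_coef a)).

(** Dropping [a i] does not raise the top bit, and the number of bit positions, one more than the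
    logarithm, is at most [2 * ell]. *)
Lemma card_dvar_rest i : #|dvar (rest_coef a i)| <= 2 * (n.-1 * ell).
Proof.
apply: leq_trans (card_dvar _) _; rewrite mulnCA mulnC leq_mul2l; apply/orP; right.
suff : top_bit (rest_coef a i) <= trunc_log 2 (max_coef a) by rewrite /ell; lia.
apply: leq_trunc_log; apply/bigmax_leqP=> r _.
exact: (leq_bigmax (lift i r)).
Qed.

Lemma card_node_rest i : #|node (B i)| <= 6 * (n ^ 2 * ell).
Proof.
apply: leq_trans (decomposed_robdd_card (robddB i)) _.
have := card_dvar_rest i; move: #|_| => d le.
have n0 : 0 < n := leq_ltn_trans (leq0n _) (ltn_ord i).
have ell0 : 0 < ell by rewrite /ell leq_max.
apply: leq_trans (_ : 2 + 2 * (n.-1 * ell) * (2 * n.-1).+1 <= _).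
  by rewrite leq_add2l leq_mul2r le orbT.
(* The terminals account for 2 of the factor 6 and the decision nodes for 4, as
   [(2 * n.-1).+1 <= 2 * n]. *)
apply: leq_trans (_ : 2 * (n ^ 2 * ell) + 2 * (n * ell) * (2 * n) <= _).
  apply: leq_add; first by rewrite -[X in X <= _]muln1 leq_mul2l muln_gt0 expn_gt0 n0.
  by apply: leq_mul; [rewrite leq_mul2l leq_mul2r leq_pred orbT | lia].
rewrite expnS expn1; nia.
Qed.

(** Per [i], the factor is [6 * k] for the diagram, 4 for two equality clauses per copy, and 1 for
    the binary clause. *)
Lemma whole_cnf_bound : size (whole_cnf E) <= (6 * k + 5) * (n ^ 3 * ell).
Proof.
rewrite size_whole_cnf.
apply: leq_trans (_ : \sum_(i < n) (6 * k + 5) * (n ^ 2 * ell) <= _); last first.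
  by rewrite sum_nat_const card_ord (expnS n 2) mulnCA !mulnA.
apply: leq_sum => i _; have [szE _] := encE i.
have nE := card_node_rest i; have dE := card_dvar_rest i.
have n0 : 0 < n := leq_ltn_trans (leq0n _) (ltn_ord i).
have ell0 : 0 < ell by rewrite /ell leq_max.
have pos : 0 < n ^ 2 * ell by rewrite muln_gt0 expn_gt0 n0.
have le : n.-1 * ell <= n ^ 2 * ell by rewrite leq_mul2r expnS expn1; nia.
have : k * #|node (B i)| <= k * (6 * (n ^ 2 * ell)) by rewrite leq_mul2l nE orbT.
by nia.
Qed.

(** Per [i], the factor is 6 for the nodes and 2 for the copies. *)
Lemma card_aux_bound : #|aux B| <= 8 * (n ^ 3 * ell).
Proof.
rewrite card_aux.
apply: leq_trans (_ : \sum_(i < n) 8 * (n ^ 2 * ell) <= _); last first.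
  by rewrite sum_nat_const card_ord (expnS n 2) mulnCA !mulnA.
apply: leq_sum => i _.
have nE := card_node_rest i; have dE := card_dvar_rest i.
have n0 : 0 < n := leq_ltn_trans (leq0n _) (ltn_ord i).
have le : n.-1 * ell <= n ^ 2 * ell by rewrite leq_mul2r expnS expn1; nia.
by lia.
Qed.

End WholeEncoding.

Theorem mainTheorem3 :
  forall k : nat, exists c : nat,
  forall (n : nat) (a : 'I_n -> nat) (K : nat)
    (B : forall i : 'I_n, bdd (dvar (rest_coef a i)))
    (E : forall i : 'I_n, cnf (dvar (rest_coef a i) + node (B i))%type),
  (forall i, 0 < a i) -> 0 < K ->
  (forall i, is_robdd (@dvar_lt _ (rest_coef a i))
               (decomposed (rest_coef a i) (rest_bound a K i)) (B i)) ->
  (forall i, is_bdd_encoding k (E i)) ->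
  (forall i, is_consistent
               (decomposed (rest_coef a i) (rest_bound a K i)) (E i)) ->
  [/\ is_GAC_encoding (pb a (Posz K)) (whole_cnf E),
      size (whole_cnf E) <= c * (n ^ 3 * maxn 1 (trunc_log 2 (max_coef a)))
    & #|aux B| <= c * (n ^ 3 * maxn 1 (trunc_log 2 (max_coef a)))].
Proof.
(* The constant dominates both [6 * k + 5] for the clauses and 8 for the variables. *)
move=> k; exists (6 * k + 8) => n a K B E _ _ robddB encE consE; split.
- by split; [apply: whole_encoding encE consE | apply: whole_GAC encE consE].
- apply: leq_trans (whole_cnf_bound robddB encE) _.
  by rewrite leq_mul2r; apply/orP; right; lia.
- apply: leq_trans (card_aux_bound robddB) _.
  by rewrite leq_mul2r; apply/orP; right; lia.
Qed.
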